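(* Let $N\ge 1$ and let $\mathcal{A}$ be a pre-hypergraph on $[N]$. Consider $\{0,1\}^{\mathcal{A}}$ as a vector space over the finite field $\mathbb{F}_2$. Then the image of $\mathcal{X}=\{0,1\}^N$ under $f_{\mathcal{A}}$ is a linear subspace of $\{0,1\}^{\mathcal{A}}$. If $\mathcal{X}=\mathbb{F}_2^N$ is also considered as a vector space over $\mathbb{F}_2$, then $f_{\mathcal{A}}$ is an injective homomorphism of $\mathbb{F}_2$-vector spaces. Its image forms an $[|\mathcal{A}|,N]$-linear code. If the elements of $\mathcal{A}$ are numbered such that the first $N$ elements are $\{1\},\dots,\{N\}$ in this order, a generator matrix of this code in standard form has as its rows the vectors $f_{\mathcal{A}}(e_i)$, $i=1,\dots,N$, where $e_i$ is the $i$-th unit vector in $\mathbb{F}_2^N$.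
   Context: Let $[N]=\{1,\dots,N\}$. A pre-hypergraph $\mathcal{A}$ on $[N]$ is a non-empty set of non-empty subsets of $[N]$ that contains all singletons (atoms) $\{i\}$, $i\in[N]$. For $\emptyset\ne A\subseteq[N]$ and $x\in\mathcal{X}=\{0,1\}^N$ put $\operatorname{supp}(x)=\{i\in[N]: x_i=1\}$ and $$f_A(x)=\begin{cases}1 & \text{if } |\operatorname{supp}(x)\cap A| \text{ is odd},\\ 0 & \text{otherwise.}\end{cases}$$ The map $f_{\mathcal{A}}:\mathcal{X}\to\{0,1\}^{\mathcal{A}}$ is $f_{\mathcal{A}}(x)=(f_A(x))_{A\in\mathcal{A}}$. A binary $[n,k]$-linear code is a linear subspace $L$ of $\mathbb{F}_2^n$ with $\dim L=k$. A generator matrix of $L$ is a $k\times n$ matrix whose rows form a basis of $L$; it is in standard form if it is of the form $(E_k,H)$ with $E_k$ the $k\times k$ identity matrix. *)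

(* Defs.v *)
From HB Require Import structures.
From mathcomp Require Import all_boot all_order all_algebra.
Set Implicit Arguments.
Unset Strict Implicit.
Unset Printing Implicit Defensive.
Import GRing.Theory.
Local Open Scope ring_scope.

(* The vertex set [N] = {1, ..., N} is 'I_N (indices shifted down by one), and
   {0,1} is identified with 'F_2 throughout, so X = {0,1}^N is 'rV['F_2]_N. *)

Definition pre_hypergraph (N : nat) (A : {set {set 'I_N}}) : Prop :=
  [/\ A != set0, set0 \notin A & forall i : 'I_N, [set i] \in A].

Definition supp (N : nat) (x : 'rV['F_2]_N) : {set 'I_N} :=
  [set i | x 0 i == 1].

Definition parity (N : nat) (B : {set 'I_N}) (x : 'rV['F_2]_N) : 'F_2 :=
  if odd #|supp x :&: B| then 1 else 0.

Definition edge (N : nat) (A : {set {set 'I_N}}) : finType :=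
  {B : {set 'I_N} | B \in A}.

(* F_2^A; the regular module ('F_2)^o provides the vector space structure. *)
Notation edge_space A := {ffun edge A -> ('F_2)^o}.

Definition parity_map (N : nat) (A : {set {set 'I_N}}) (x : 'rV['F_2]_N) :
  edge_space A := [ffun B : edge A => parity (val B) x : ('F_2)^o].

(* A numbering s of the elements of A identifies F_2^A with F_2^|A|; it is
   meant to be used with s bijective. *)
Definition numbered (N : nat) (A : {set {set 'I_N}}) (s : 'I_#|A| -> edge A)
  (y : edge_space A) : 'rV['F_2]_#|A| := \row_j y (s j).

(* Since |A| >= N for a pre-hypergraph A, each i < N does occur as some j. *)
Definition atoms_first (N : nat) (A : {set {set 'I_N}})
  (s : 'I_#|A| -> edge A) : Prop :=
  forall (i : 'I_N) (j : 'I_#|A|), j = i :> nat -> val (s j) = [set i].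

Definition binary_linear_code (n k : nat) (L : {vspace 'rV['F_2]_n}) : Prop :=
  \dim L = k.

Definition generator_matrix (n k : nat) (L : {vspace 'rV['F_2]_n})
  (G : 'M['F_2]_(k, n)) : bool :=
  basis_of L [seq row i G | i : 'I_k].

Definition standard_form (n k : nat) (G : 'M['F_2]_(k, n)) : Prop :=
  exists (m : nat) (e : (k + m)%N = n) (H : 'M['F_2]_(k, m)),
    G = castmx (erefl k, e) (row_mx 1%:M H).

(* Main.v *)
(** Over F_2, the parity [f_B(x)] is the linear form [x |-> \sum_(i in B) x_i].
    Hence [f_A] is linear; the atoms of [A] recover the coordinates of [x], so it
    is injective and its image has the [f_A(e_i)] as a basis. Restricted to the
    atoms, these vectors form the identity matrix. *)

Require Import Defs.
From HB Require Import structures.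
From mathcomp Require Import all_boot all_order all_algebra.
Import GRing.Theory.
Local Open Scope ring_scope.

Section LinearImage.
Variables (F : fieldType) (n : nat) (V : vectType F) (f : {linear 'rV[F]_n -> V}).

(** Links the subspace [limg (linfun f)] with the plain set of values of [f], the form in which
    [codom] is unfolded. *)
Lemma mem_limg_linfun v :
  reflect (exists x, v = f x) (v \in limg (linfun f)).
Proof.
apply: (iffP memv_imgP) => [[x _ ->]|[x ->]]; exists x; rewrite ?lfunE //.
exact: memvf.
Qed.

Lemma dim_limg_linfun : injective f -> \dim (limg (linfun f)) = n.
Proof.
move=> inj_f; rewrite limg_dim_eq ?dimvf /dim /= ?mul1n //.
apply/eqP; rewrite capfv; apply/lker0P => x y.
by rewrite !lfunE; apply: inj_f.
Qed.

(** These are [n] vectors in a space of dimension [n], so it suffices that they span it. Spanning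
    follows by expanding [x] in unit vectors. *)
Lemma delta_mx_basis_limg : injective f ->
  basis_of (limg (linfun f)) [seq f (delta_mx 0 i) | i : 'I_n].
Proof.
move=> inj_f; rewrite basisEdim size_map -cardE card_ord dim_limg_linfun //.
rewrite leqnn andbT; apply/subvP => _ /mem_limg_linfun[x ->].
rewrite [x]row_sum_delta linear_sum memv_suml // => i _.
by rewrite linearZ memvZ // memv_span // image_f.
Qed.

End LinearImage.

Lemma card_supp_natr (N : nat) (B : {set 'I_N}) (x : 'rV['F_2]_N) :
  (#|supp x :&: B|)%:R = \sum_(i in B) x 0 i.
Proof.
rewrite -sum1_card natr_sum (eq_bigl (fun i => (i \in B) && (x 0 i == 1))).
  rewrite big_mkcondr; apply: eq_bigr => i _.
  (* An element of ['F_2] is 0 or 1, so it equals the indicator of being 1. *)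
  by case: (x 0 i) => -[|[|//]] lt_i; apply/val_inj.
by move=> i; rewrite !inE andbC.
Qed.

Lemma parityE (N : nat) (B : {set 'I_N}) (x : 'rV['F_2]_N) :
  parity B x = \sum_(i in B) x 0 i.
Proof.
rewrite -card_supp_natr /parity; apply/val_inj.
(* The image of a natural number in ['F_2] is its residue mod 2, that is, its parity. *)
by rewrite Zp_nat /= modn2; case: odd.
Qed.

Lemma parity_set1 (N : nat) (i : 'I_N) (x : 'rV['F_2]_N) :
  parity [set i] x = x 0 i.
Proof. by rewrite parityE big_set1. Qed.

Lemma parity_map_is_linear (N : nat) (A : {set {set 'I_N}}) :
  linear (@parity_map N A).
Proof.
move=> a x y; apply/ffunP => B; rewrite !ffunE !parityE.
rewrite scaler_sumr -big_split; apply: eq_bigr => i _.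
by rewrite !mxE.
Qed.

HB.instance Definition _ (N : nat) (A : {set {set 'I_N}}) :=
  GRing.isLinear.Build _ _ _ _ _ (@parity_map_is_linear N A).

Lemma parity_map_inj (N : nat) (A : {set {set 'I_N}}) :
  (forall i, [set i] \in A) -> injective (@parity_map N A).
Proof.
move=> atomA x y /ffunP eq_xy; apply/rowP => i.
by have := eq_xy (Sub [set i] (atomA i)); rewrite !ffunE SubK !parity_set1.
Qed.

Lemma numbered_is_linear (N : nat) (A : {set {set 'I_N}})
  (s : 'I_#|A| -> edge A) : linear (numbered s).
Proof. by move=> a y z; apply/rowP => j; rewrite !mxE !ffunE. Qed.

HB.instance Definition _ (N : nat) (A : {set {set 'I_N}})
    (s : 'I_#|A| -> edge A) :=
  GRing.isLinear.Build _ _ _ _ _ (@numbered_is_linear N A s).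

(** With [t] inverse to [s], the value of [y] at [B] is read off at coordinate [t B]. *)
Lemma numbered_inj (N : nat) (A : {set {set 'I_N}}) (s : 'I_#|A| -> edge A) :
  bijective s -> injective (numbered s).
Proof.
case=> t _ tK y z /rowP eq_yz; apply/ffunP => B.
by have := eq_yz (t B); rewrite !mxE tK.
Qed.

Lemma leq_card_atoms (N : nat) (A : {set {set 'I_N}}) :
  (forall i, [set i] \in A) -> (N <= #|A|)%N.
Proof.
move=> atomA; rewrite -{1}[N]card_ord -(card_imset _ (@set1_inj 'I_N)).
by apply/subset_leq_card/subsetP => _ /imsetP[i _ ->].
Qed.

Lemma parity_matrix_standard_form (N : nat) (A : {set {set 'I_N}})
    (s : 'I_#|A| -> edge A) :
  (forall i, [set i] \in A) -> atoms_first s ->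
  standard_form (\matrix_(i < N) numbered s (parity_map A (delta_mx 0 i))).
Proof.
move=> /leq_card_atoms leNA firsts; set G := \matrix_i _.
(* [G'] is [G] with its columns indexed by [N + (#|A| - N)], so that it splits into two blocks; the
   right one serves as [H]. *)
pose e := subnKC leNA; pose G' := castmx (erefl N, esym e) G.
exists (#|A| - N)%N, e, (rsubmx G').
suff <- : lsubmx G' = 1%:M by rewrite hsubmxK castmxKV.
apply/matrixP => i j; rewrite !mxE castmxE !mxE cast_ord_id ffunE esymK.
(* Casting and left inclusion keep the value of [j], so column [j] belongs to the atom of [j] and
   the entry is coordinate [j] of the [i]-th unit vector. *)
by rewrite (firsts j) // parity_set1 !mxE eqxx eq_sym.
Qed.

Theorem proposition10 (N : nat) (N_ge1 : (1 <= N)%N)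
    (A : {set {set 'I_N}}) (hA : pre_hypergraph A) :
  [/\ exists L : {vspace edge_space A}, L =i codom (@parity_map N A),
      linear (@parity_map N A) /\ injective (@parity_map N A)
    & forall s : 'I_#|A| -> edge A, bijective s ->
      exists L : {vspace 'rV['F_2]_#|A|},
      [/\ L =i codom (fun x => numbered s (parity_map A x)),
          binary_linear_code N L
        & atoms_first s ->
          let G := \matrix_(i < N) numbered s (parity_map A (delta_mx 0 i)) in
          generator_matrix L G /\ standard_form G]].
Proof.
have [_ _ atomA] := hA; have inj_f := @parity_map_inj N A atomA.
split; last 1 first.
(* The code in coordinates is the image of the injective linear map [g], so the general lemmas on
   images apply. *)
- move=> s bij_s; pose g : {linear _ -> _} := numbered s \o @parity_map N A.
  have inj_g : injective g by apply: inj_comp inj_f; apply: numbered_inj.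
  exists (limg (linfun g)); split; last 1 first.
  + move=> firsts G; split; last exact: parity_matrix_standard_form.
    rewrite /generator_matrix (eq_image (frefl _) (fun i => rowK _ i)).
    exact: delta_mx_basis_limg.
  + by move=> y; apply/mem_limg_linfun/codomP.
  + exact: dim_limg_linfun.
- exists (limg (linfun (@parity_map N A))) => y.
  by apply/mem_limg_linfun/codomP.
- by split=> //; apply: parity_map_is_linear.
Qed.
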